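(* Let $k\in\mathbb{N}$ and let $((t^n_1,\ldots,t^n_n))_{n\in\mathbb{N}}$ be a sequence of tuples of integers with $t^n_1<\ldots<t^n_n$ and $|t^n_j|\geq k$ for every $1\leq j\leq n$, $n\in\mathbb{N}$. If $A\subseteq\mathbb{Q}$ satisfies $$\limsup_{n\to\infty}\frac{|A\cap\mathbb{Q}(t^n_1,\ldots,t^n_n,k)|}{k^{n}}>0,$$ then there exist $p\in A$ with $p\neq 0$ and $q\in\mathbb{Q}^{\ast}$ with $dom(p),dom(q)\subseteq\{t^n_1,\ldots,t^n_n\}$ for some $n\in\mathbb{N}$, such that $$p+iq\in A\quad\text{for every } i=0,1,\ldots,k-1.$$
   Context: Notation: $\mathbb{N}=\{1,2,\ldots\}$, $\mathbb{Z}^{\ast}=\mathbb{Z}\setminus\{0\}$, $\mathbb{Q}^{\ast}=\mathbb{Q}\setminus\{0\}$, and $|B|$ denotes the cardinality of a set $B$. Representation of rationals (known fact): every rational number $q$ has a unique expression $$q=\sum_{s=1}^{\infty}q_{-s}\frac{(-1)^{s}}{(s+1)!}+\sum_{r=1}^{\infty}q_{r}(-1)^{r+1}r!,$$ where $(q_n)_{n\in\mathbb{Z}^{\ast}}\subseteq\mathbb{N}\cup\{0\}$, $0\leq q_{-s}\leq s$ for every $s>0$, $0\leq q_r\leq r$ for every $r>0$, and $q_{-s}=q_r=0$ for all but finitely many $r,s$. For $q\in\mathbb{Q}^{\ast}$, the domain of $q$ is the non-empty finite set $dom(q)=\{t\in\mathbb{Z}^{\ast}: q_t\neq 0\}$.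 For $n,k\in\mathbb{N}$ and integers $t^n_1<\ldots<t^n_n$ with $|t^n_j|\geq k$ for every $1\leq j\leq n$, define the subset of $\mathbb{Q}^{\ast}$ $$\mathbb{Q}(t^n_1,\ldots,t^n_n,k)=\Big\{\sum_{j=1}^{n}q_{t^n_j}c_{t^n_j}:\ q_{t^n_j}\in\mathbb{N},\ 1\leq q_{t^n_j}\leq k\Big\},$$ where, for $t\in\mathbb{Z}^{\ast}$, $c_t=\frac{(-1)^{-t}}{(-t+1)!}$ if $t<0$ and $c_t=(-1)^{t+1}t!$ if $t>0$. *)

(* Defs.v *)
From HB Require Import structures.
From mathcomp Require Import all_boot all_order all_algebra.
From mathcomp Require Import all_classical all_reals all_analysis.

Set Implicit Arguments.
Unset Strict Implicit.
Unset Printing Implicit Defensive.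

Import Order.TTheory GRing.Theory Num.Theory.

Local Open Scope classical_set_scope.
Local Open Scope ring_scope.

(* c_t for t <> 0, with |t| = - t when t < 0; the value at t = 0 is never
   used. *)
Definition rat_coef (t : int) : rat :=
  if t < 0 then (-1) ^+ `|t|%N / ((`|t|%N.+1)`!)%:R
  else (-1) ^+ `|t|%N.+1 * (`|t|%N`!)%:R.

(* [a] is the family of digits of [q]. Digits are indexed by all integers, but
   the bound a_t <= |t| forces a_0 = 0. The sums over infinite sets are
   fsbigop sums, which are the true sums because the support is finite. *)
Definition is_digits (q : rat) (a : int -> nat) : Prop :=
  [/\ finite_set [set t | a t != 0%N],
      forall t, (a t <= `|t|)%N
    & q = \sum_(s \in [set s : nat | (0 < s)%N])
              (a (- s%:Z))%:R * ((-1) ^+ s / ((s.+1)`!)%:R : rat)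
        + \sum_(r \in [set r : nat | (0 < r)%N])
              (a r%:Z)%:R * ((-1) ^+ r.+1 * (r`!)%:R : rat)].

(* Every rational has exactly one family of digits, so the default value of
   [xget] is irrelevant. *)
Definition digits (q : rat) : int -> nat := xget (fun=> 0%N) (is_digits q).

Definition dom (q : rat) : set int := [set t | t != 0 /\ digits q t != 0%N].

(* The set Q(t_1, ..., t_n, k). *)
Definition rat_span (n : nat) (t : n.-tuple int) (k : nat) : set rat :=
  [set q | exists a : 'I_n -> nat,
      (forall j, (1 <= a j <= k)%N) /\
      q = \sum_(j < n) (a j)%:R * rat_coef (tnth t j)].

(* Main.v *)
Require Import Defs.
From HB Require Import structures.
From mathcomp Require Import all_boot all_order all_algebra.
From mathcomp Require Import finmap.
From mathcomp Require Import all_classical all_reals all_analysis.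
From mathcomp Require Import lra zify.

(**
The digits of a rational number form a mixed-radix expansion on both sides of
the radix point: in the order t = -N, ..., -1, 1, ..., N the absolute values of
the c_t grow in such a way that |t| |c_t| <= |c_t'| - |c_t|, where t' is the
index that follows t.  This makes the digits unique.  As k <= |t_j|, a number
of Q(t_1, ..., t_n, k) is therefore the same thing as a word of length n over
k letters, and a combinatorial line of words is a progression p, p + q, ...,
p + (k - 1) q, where q is the sum of the c_t over the wildcard positions.  So
the theorem follows from the density Hales-Jewett theorem: for d > 0 and n
large, every set of words of length n over k letters that has density at least
d contains a combinatorial line.

The density Hales-Jewett theorem is proved by induction on the alphabet, from
T to [option T] ([DHJ_step]), along the lines of the proof of Polymath in the
form given to it by Dodos, Kanellopoulos and Tyros.  Let D be the supremum of
the densities c such that in every dimension some line-free set over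
[option T] has density at least c, and suppose D > 0.

Take a line-free set A of density almost D in a large dimension.  No fibre of A
over a bounded number of coordinates is much denser than D, so that none is
much thinner either ([fibre_density]).  The fibres over the words of T alone
thus have density at least D / 2, and the theorem for T provides many lines
over T in A.  A pattern of such a line is a word w over [option T] in which the
new letter None marks the wildcards.  The sampling lemma ([sampling]) arranges
these patterns into a whole cube, in which the patterns w with all the points
w(None := a), for a in T, in A form a set of density bounded below.  This set
is the intersection over a of sets that do not see the difference between None
and a, here called insensitive.  It is disjoint from A, because w itself would
be the missing point of a line over [option T].  Hence A has to live in the
complement, a union of insensitive sets, which is too small for it unless A
has density larger than D by a fixed amount on this union.

But an insensitive set is essentially a set of words over T, so that the
theorem for T, in its version for subspaces ([DHJ_MDHJ]), exhausts
it up to a small error by disjoint subspaces of a prescribed dimension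
([tiling], [union_tiling]).  On each subspace a line-free set has density at
most D + e by the choice of D, hence also on the union: a contradiction.
*)

Set Implicit Arguments.
Unset Strict Implicit.
Unset Printing Implicit Defensive.

Import Order.TTheory GRing.Theory Num.Theory.

Local Open Scope classical_set_scope.
Local Open Scope ring_scope.

(** * Words, subspaces and lines *)

Section Words.
Implicit Types I J T : finType.

Definition word I T : finType := {ffun I -> T}.

(** A subspace of the words over [T] indexed by [I], with wildcards named by
[J]: each position carries either a fixed letter or a wildcard.  The subspaces
over [T] with index set [I] are themselves words over the alphabet [T + J], a
fact on which the choice of a random subspace relies. *)
Definition subsp I J T : finType := {ffun I -> T + J}.

Definition sapply I J T (f : subsp I J T) (w : word J T) : word I T :=
  [ffun i => match f i with inl a => a | inr j => w j end].

Definition nondeg I J T (f : subsp I J T) : bool :=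
  [forall j, exists i, f i == inr j].

Definition wcat I J T (u : word I T) (v : word J T) : word (I + J)%type T :=
  [ffun s => match s with inl i => u i | inr j => v j end].

Definition wmap I (T T' : finType) (g : T -> T') (u : word I T) : word I T' :=
  [ffun i => g (u i)].

Lemma wcat_bij I J T :
  bijective (fun p : word I T * word J T => wcat p.1 p.2).
Proof.
exists (fun w : word (I + J)%type T =>
  ([ffun i => w (inl i)] : word I T, [ffun j => w (inr j)] : word J T)).
  by move=> [u v] /=; congr (_, _); apply/ffunP => i; rewrite !ffunE.
by move=> w; apply/ffunP => -[i|j]; rewrite !ffunE.
Qed.

Lemma sapply_inj I J T (f : subsp I J T) : nondeg f -> injective (sapply f).
Proof.
move=> /forallP nf u v uv; apply/ffunP => j; have /existsP[i /eqP fi] := nf j.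
by have /ffunP/(_ i) := uv; rewrite !ffunE fi.
Qed.

Lemma nondegP I J T (f : subsp I J T) :
  reflect (forall j, exists i, f i = inr j) (nondeg f).
Proof.
apply: (iffP forallP) => H j; first by have /existsP[i /eqP] := H j; exists i.
by have [i fi] := H j; apply/existsP; exists i; rewrite fi.
Qed.

Definition scomp I J L T (f : subsp I J T) (g : subsp J L T) : subsp I L T :=
  [ffun i => match f i with inl a => inl a | inr j => g j end].

Lemma sapply_comp I J L T (f : subsp I J T) (g : subsp J L T) w :
  sapply (scomp f g) w = sapply f (sapply g w).
Proof. by apply/ffunP => i; rewrite !ffunE; case: (f i) => // j; rewrite ffunE. Qed.

Lemma nondeg_comp I J L T (f : subsp I J T) (g : subsp J L T) :
  nondeg f -> nondeg g -> nondeg (scomp f g).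
Proof.
move=> /nondegP nf /nondegP ng; apply/nondegP => l.
have [j gj] := ng l; have [i fi] := nf j.
by exists i; rewrite ffunE fi gj.
Qed.

Definition scat I1 I2 J1 J2 T (f : subsp I1 J1 T) (g : subsp I2 J2 T) :
    subsp (I1 + I2)%type (J1 + J2)%type T :=
  [ffun s => match s with
    | inl i => match f i with inl a => inl a | inr j => inr (inl j) end
    | inr i => match g i with inl a => inl a | inr j => inr (inr j) end
  end].

Lemma sapply_cat I1 I2 J1 J2 T (f : subsp I1 J1 T) (g : subsp I2 J2 T) u v :
  sapply (scat f g) (wcat u v) = wcat (sapply f u) (sapply g v).
Proof.
apply/ffunP => -[i|i]; rewrite !ffunE.
  by case: (f i) => // j; rewrite ffunE.
by case: (g i) => // j; rewrite ffunE.
Qed.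

Lemma nondeg_cat I1 I2 J1 J2 T (f : subsp I1 J1 T) (g : subsp I2 J2 T) :
  nondeg f -> nondeg g -> nondeg (scat f g).
Proof.
move=> /nondegP nf /nondegP ng; apply/nondegP => -[j|j].
  by have [i fi] := nf j; exists (inl i); rewrite ffunE fi.
by have [i fi] := ng j; exists (inr i); rewrite ffunE fi.
Qed.

Definition scatl I1 I2 J T (x : word I1 T) (g : subsp I2 J T) :
    subsp (I1 + I2)%type J T :=
  [ffun s => match s with inl i => inl (x i) | inr i => g i end].
Definition scatr I1 I2 J T (f : subsp I1 J T) (x : word I2 T) :
    subsp (I1 + I2)%type J T :=
  [ffun s => match s with inl i => f i | inr i => inl (x i) end].

Lemma sapply_catl I1 I2 J T (x : word I1 T) (g : subsp I2 J T) u :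
  sapply (scatl x g) u = wcat x (sapply g u).
Proof. by apply/ffunP => -[i|i]; rewrite !ffunE. Qed.
Lemma sapply_catr I1 I2 J T (f : subsp I1 J T) (x : word I2 T) u :
  sapply (scatr f x) u = wcat (sapply f u) x.
Proof. by apply/ffunP => -[i|i]; rewrite !ffunE. Qed.
Lemma nondeg_catl I1 I2 J T (x : word I1 T) (g : subsp I2 J T) :
  nondeg g -> nondeg (scatl x g).
Proof.
by move=> /nondegP ng; apply/nondegP => j; have [i gi] := ng j; exists (inr i);
  rewrite ffunE.
Qed.
Lemma nondeg_catr I1 I2 J T (f : subsp I1 J T) (x : word I2 T) :
  nondeg f -> nondeg (scatr f x).
Proof.
by move=> /nondegP ng; apply/nondegP => j; have [i gi] := ng j; exists (inl i);
  rewrite ffunE.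
Qed.

Definition sid J T : subsp J J T := [ffun j => inr j].
Lemma sapply_id J T (w : word J T) : sapply (sid J T) w = w.
Proof. by apply/ffunP => j; rewrite !ffunE. Qed.
Lemma nondeg_id J T : nondeg (sid J T).
Proof. by apply/nondegP => j; exists j; rewrite ffunE. Qed.

(** The pattern of a line over [T] is a word over [option T] in which [None] is
the wildcard.  Thus the new letter of the alphabet [option T] doubles as a
wildcard for words over [T]. *)
Definition fill I T (L : word I (option T)) (a : T) : word I T :=
  [ffun i => odflt a (L i)].

Definition pattern I T (L : word I (option T)) : bool := [exists i, L i == None].

Definition line_free I T (A : word I T -> bool) : Prop :=
  forall L, pattern L -> exists a, ~~ A (fill L a).

Lemma patternP I T (L : word I (option T)) :
  reflect (exists i, L i = None) (pattern L).
Proof.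
by apply: (iffP existsP) => -[i /eqP]; exists i => //; apply/eqP.
Qed.

Definition spat I J T (f : subsp I J T) (L : word J (option T)) :
    word I (option T) :=
  [ffun i => match f i with inl a => Some a | inr j => L j end].

Lemma fill_spat I J T (f : subsp I J T) (L : word J (option T)) a :
  fill (spat f L) a = sapply f (fill L a).
Proof. by apply/ffunP => i; rewrite !ffunE; case: (f i) => // j; rewrite ffunE. Qed.

Lemma pattern_spat I J T (f : subsp I J T) (L : word J (option T)) :
  nondeg f -> pattern L -> pattern (spat f L).
Proof.
move=> /nondegP nf /patternP[j Lj]; have [i fi] := nf j.
by apply/patternP; exists i; rewrite ffunE fi.
Qed.

Lemma line_free_sapply I J T (f : subsp I J T) (A : word I T -> bool) :
  nondeg f -> line_free A -> line_free (A \o sapply f).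
Proof.
move=> nf lA L pL; have [a] := lA _ (pattern_spat nf pL).
by rewrite fill_spat; exists a.
Qed.

End Words.

(** * Averages *)

Section DensityHalesJewett.
Context {R : realType}.
Implicit Types I J T X Y Z : finType.

Definition mean X (f : X -> R) : R := (\sum_x f x) / #|X|%:R.

Lemma eq_mean X (f g : X -> R) : f =1 g -> mean f = mean g.
Proof. by move=> fg; congr (_ / _); apply: eq_bigr => x _. Qed.

Lemma ler_mean X (f g : X -> R) : (forall x, f x <= g x) -> mean f <= mean g.
Proof.
by move=> fg; apply: ler_wpM2r; rewrite ?invr_ge0 ?ler0n//; apply: ler_sum.
Qed.

Lemma meanD X (f g : X -> R) : mean (fun x => f x + g x) = mean f + mean g.
Proof. by rewrite /mean big_split mulrDl. Qed.

Lemma meanZ X a (f : X -> R) : mean (fun x => a * f x) = a * mean f.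
Proof. by rewrite /mean -mulr_sumr mulrA. Qed.

Lemma meanN X (f : X -> R) : mean (fun x => - f x) = - mean f.
Proof. by rewrite /mean sumrN mulNr. Qed.

Lemma meanB X (f g : X -> R) : mean (fun x => f x - g x) = mean f - mean g.
Proof. by rewrite meanD meanN. Qed.

Lemma mean_sum X Z (f : Z -> X -> R) :
  mean (fun x => \sum_z f z x) = \sum_z mean (f z).
Proof. by rewrite /mean exchange_big mulr_suml. Qed.

Lemma mean_cst X (x0 : X) (a : R) : mean (fun _ : X => a) = a.
Proof.
have X0 : (0 < #|X|)%N by apply/card_gt0P; exists x0.
by rewrite /mean sumr_const -[X in X / _]mulr_natr mulfK// pnatr_eq0 -lt0n.
Qed.

Lemma mean_ge0 X (f : X -> R) : (forall x, 0 <= f x) -> 0 <= mean f.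
Proof. by move=> f0; apply: divr_ge0; rewrite ?ler0n//; apply: sumr_ge0. Qed.

Lemma mean_le X (f : X -> R) a : 0 <= a -> (forall x, f x <= a) -> mean f <= a.
Proof.
move=> a0 fa; have [X0|] := posnP #|X|.
  by rewrite /mean X0 invr0 mulr0.
move=> /card_gt0P[x0 _].
by rewrite -[leRHS](mean_cst x0); apply: ler_mean.
Qed.

Lemma mean_ge X (x0 : X) (f : X -> R) a : (forall x, a <= f x) -> a <= mean f.
Proof. by move=> fa; rewrite -[leLHS](mean_cst x0); apply: ler_mean. Qed.

Lemma mean_bij X Y (h : X -> Y) (f : Y -> R) :
  bijective h -> mean f = mean (f \o h).
Proof.
move=> bh; rewrite /mean (bij_eq_card bh); congr (_ / _).
by rewrite (reindex h) //; exact: onW_bij.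
Qed.

Lemma mean_pair X Y (f : X * Y -> R) :
  mean f = mean (fun x => mean (fun y => f (x, y))).
Proof.
rewrite /mean card_prod natrM invfM mulrA.
transitivity ((\sum_x \sum_y f (x, y)) / #|X|%:R / #|Y|%:R).
  by rewrite pair_big; congr (_ / _ / _); apply: eq_bigr => -[].
by rewrite -mulr_suml mulrAC.
Qed.

Lemma mean_exchange X Y (f : X -> Y -> R) :
  mean (fun x => mean (f x)) = mean (fun y => mean (f^~ y)).
Proof.
rewrite -(mean_pair (fun p => f p.1 p.2)).
have bsw : bijective (fun p : Y * X => (p.2, p.1)).
  by exists (fun p : X * Y => (p.2, p.1)) => -[].
by rewrite (mean_bij _ bsw) mean_pair.
Qed.

Lemma mean_gt0_ex X (f : X -> bool) :
  0 < mean (fun x => (f x)%:R) -> exists x, f x.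
Proof.
move=> H; apply: contrapT => nf; move: H; rewrite ltNge => /negP; apply.
apply: mean_le => // x; rewrite lern0; case fx: (f x) => //.
by case: nf; exists x.
Qed.

(** At least a proportion [d / 2] of the [y] satisfies [d / 2 <= g y], since the
others contribute at most [d / 2] to the mean of [g <= 1].  Each of these [y]
chooses one of finitely many [z]. *)
Lemma mean_pigeonhole Y Z (g : Y -> R) (P : Z -> Y -> bool) (d : R) :
    0 < d -> (forall y, g y <= 1) -> d <= mean g ->
    (forall y, d / 2 <= g y -> exists z, P z y) ->
  (0 < #|Z|)%N /\
  exists z, d / 2 / #|Z|%:R <= mean (fun y => (P z y)%:R).
Proof.
move=> d0 g1 dg gP.
have sumP : d / 2 <= \sum_z mean (fun y => (P z y)%:R).
  rewrite -mean_sum.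
  have : mean g <= mean (fun y => d / 2 + \sum_z (P z y)%:R).
    apply: ler_mean => y; case: (leP (d / 2) (g y)) => [/gP[z Pzy]|gd].
      rewrite (bigD1 z)//= Pzy mulr1n.
      have : 0 <= \sum_(i | i != z) (P i y)%:R :> R by apply: sumr_ge0.
      by have := g1 y; lra.
    apply: ltW; apply: (lt_le_trans gd); rewrite lerDl; exact: sumr_ge0.
  rewrite meanD => H.
  have : mean (fun _ : Y => d / 2) <= d / 2 by apply: mean_le => //; lra.
  lra.
have Z0 : (0 < #|Z|)%N.
  rewrite lt0n; apply/negP => /eqP /card0_eq Z0.
  by move: sumP; rewrite big_pred0 //; lra.
split=> //; apply: contrapT => nz.
move: sumP; rewrite leNgt => /negP; apply.
have /card_gt0P[z0 _] := Z0.
rewrite [ltRHS](_ : _ = \sum_(z : Z) d / 2 / #|Z|%:R); last first.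
  by rewrite sumr_const -[RHS]mulr_natr divfK// pnatr_eq0 -lt0n.
apply: ltr_sum; first by apply/hasP; exists z0; rewrite // mem_index_enum.
by move=> z _; rewrite ltNge; apply/negP => ?; apply: nz; exists z.
Qed.

Lemma exp_small (x e : R) :
  0 <= x < 1 -> 0 < e -> exists s, x ^+ s <= e.
Proof.
move=> /andP[x0 x1] e0.
have nx : `|x| < 1 by rewrite ger0_norm.
have /cvgrPdist_le /(_ e e0)[s _ Hs] := cvg_expr nx; exists s.
have := Hs s (leqnn s).
by rewrite sub0r normrN /= ger0_norm ?exprn_ge0.
Qed.

Lemma option_ord_bij n : bijective
  (fun o : option 'I_n => if o is Some j then lift ord_max j else ord_max).
Proof.
exists (unlift ord_max) => [[j|]|i]; first exact: liftK.
  exact: unlift_none.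
by case: unliftP.
Qed.

(** Index sets are arbitrary finite types, so that a product of two cubes is
the cube indexed by a sum, without casts.  The induction on the dimension then
has to be invariant under bijections. *)
Lemma finType_ind (P : finType -> Prop) :
    (forall (J J' : finType) (h : J -> J'), bijective h -> P J -> P J') ->
    P void -> (forall J : finType, P J -> P (option J)) ->
  forall J, P J.
Proof.
move=> Pbij P0 PS.
have PI n : P 'I_n.
  elim: n => [|n IHn].
    by apply: (Pbij void _ (of_void _)) => //; apply: inj_card_bij => [[]|];
      rewrite card_ord.
  exact: (Pbij _ _ _ (@option_ord_bij n) (PS _ IHn)).
by move=> J; exact: (Pbij _ _ _ (@enum_val_bij J) (PI _)).
Qed.

Lemma mean_wcat I J T (F : word (I + J)%type T -> R) :
  mean F = mean (fun u => mean (fun v => F (wcat u v))).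
Proof. by rewrite (mean_bij _ (@wcat_bij I J T)) mean_pair. Qed.

(** * The density Hales-Jewett property and its version for subspaces *)

Definition density T (A : T -> bool) : R := mean (fun x => (A x)%:R).

Lemma density_ge0 T (A : T -> bool) : 0 <= density A.
Proof. by apply: mean_ge0 => x; rewrite ler0n. Qed.

Lemma density_le1 T (A : T -> bool) : density A <= 1.
Proof. by apply: mean_le => // x; rewrite lern1 leq_b1. Qed.

(** One dimension is enough for the definition: a line in some fibre gives one
in each larger dimension, see [DHJ_large]. *)
Definition DHJ T : Prop := forall d : R, 0 < d ->
  exists I, forall A : word I T -> bool, d <= density A ->
    exists2 L, pattern L & forall a, A (fill L a).

Definition MDHJ T : Prop := forall J (d : R), 0 < d ->
  exists I, forall A : word I T -> bool, d <= density A ->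
    exists2 f : subsp I J T, nondeg f & forall w, A (sapply f w).

Definition line_subsp I1 I2 J T (L : word I1 (option T)) (f : subsp I2 J T) :
    subsp (I1 + I2)%type (option J) T :=
  [ffun s => match s with
    | inl i => if L i is Some a then inl a else inr None
    | inr i => match f i with inl a => inl a | inr j => inr (Some j) end
  end].

Lemma sapply_line_subsp I1 I2 J T (L : word I1 (option T)) (f : subsp I2 J T) w :
  sapply (line_subsp L f) w =
  wcat (fill L (w None)) (sapply f [ffun j => w (Some j)]).
Proof.
apply/ffunP => -[i|i]; rewrite !ffunE; first by case: (L i).
by case: (f i) => // j; rewrite ffunE.
Qed.

Lemma nondeg_line_subsp I1 I2 J T (L : word I1 (option T)) (f : subsp I2 J T) :
  pattern L -> nondeg f -> nondeg (line_subsp L f).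
Proof.
move=> /patternP[i Li] /nondegP nf; apply/nondegP => -[j|].
  by have [i' fi'] := nf j; exists (inr i'); rewrite ffunE fi'.
by exists (inl i); rewrite ffunE Li.
Qed.

Definition sren I J J' T (h : J -> J') (f : subsp I J T) : subsp I J' T :=
  [ffun i => match f i with inl a => inl a | inr j => inr (h j) end].

Lemma sapply_ren I J J' T (h : J -> J') (f : subsp I J T) w :
  sapply (sren h f) w = sapply f [ffun j => w (h j)].
Proof. by apply/ffunP => i; rewrite !ffunE; case: (f i) => // j; rewrite ffunE. Qed.

Lemma nondeg_ren I J J' T (h : J -> J') (f : subsp I J T) :
  bijective h -> nondeg f -> nondeg (sren h f).
Proof.
move=> [g hg gh] /nondegP nf; apply/nondegP => j; have [i fi] := nf (g j).
by exists i; rewrite ffunE fi gh.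
Qed.

(** One wildcard at a time.  In a product of two cubes many fibres contain a
line, hence many of them contain the same line, there being finitely many; the
set of these fibres is dense in the second factor and contains a subspace by
induction. *)
Lemma DHJ_MDHJ T : DHJ T -> MDHJ T.
Proof.
move=> dhj; apply: finType_ind => [J J' h bh IH d d0||J IH d d0].
- have [I HI] := IH d d0; exists I => A /HI[f nf fA].
  exists (sren h f); first exact: nondeg_ren.
  by move=> w; rewrite sapply_ren.
- move=> d d0; exists void => A dA.
  have [x Ax] : exists x, A x by apply/mean_gt0_ex/lt_le_trans/dA.
  exists (sid void T); first exact: nondeg_id.
  by move=> w; rewrite sapply_id (_ : w = x)//; apply/ffunP => -[].
have [I1 HI1] := dhj (d / 2) ltac:(lra).
pose d' := d / 2 / #|word I1 (option T)|%:R.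
have [N0|N0] := posnP #|word I1 (option T)|.
  exists I1 => A dA; have [|L _ _] := HI1 A; first by lra.
  by have := card0_eq N0 L.
have d'0 : 0 < d' by rewrite divr_gt0 ?divr_gt0 ?ltr0n.
have [I2 HI2] := IH d' d'0.
exists (I1 + I2)%type => A dA.
have dA' : d <= mean (fun y : word I2 T => density (fun x : word I1 T => A (wcat x y))).
  by move: dA; rewrite /density mean_wcat mean_exchange.
have [|y dy|_ [L]] := @mean_pigeonhole _ _ _
    (fun (L : word I1 (option T)) y => pattern L && [forall a, A (wcat (fill L a) y)])
    d d0 _ dA'.
- by move=> y; exact: density_le1.
- have [L pL LA] := HI1 _ dy; exists L; rewrite pL /=; exact/forallP.
rewrite -/d' => HL.
have pL : pattern L.
  have [x] := mean_gt0_ex (lt_le_trans d'0 HL).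
  by case/andP.
have [f nf fA] := HI2 _ HL.
exists (line_subsp L f); first exact: nondeg_line_subsp.
move=> w; rewrite sapply_line_subsp.
by have /andP[_ /forallP] := fA [ffun j => w (Some j)]; apply.
Qed.

(** * Sampling a cube over a smaller alphabet *)

Definition letter_subsp I T (x : word I T) : subsp (option I) unit T :=
  [ffun o => if o is Some i then inl (x i) else inr tt].

Definition wcons I T (a : T) (x : word I T) : word (option I) T :=
  [ffun o => if o is Some i then x i else a].

Lemma wcons_bij I T : bijective (fun p : T * word I T => wcons p.1 p.2).
Proof.
exists (fun w : word (option I) T => (w None, [ffun i => w (Some i)] : word I T)).
  by move=> [a u] /=; rewrite ffunE; congr (_, _); apply/ffunP => i; rewrite !ffunE.
by move=> w; apply/ffunP => -[i|]; rewrite !ffunE.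
Qed.

Lemma mean_wcons I T (F : word (option I) T -> R) :
  mean F = mean (fun a => mean (fun x => F (wcons a x))).
Proof. by rewrite (mean_bij _ (@wcons_bij I T)) mean_pair. Qed.

(** Let [g] be an injection of [T1] into [T2].  A word over [T2] that uses the
image of [g] is split at the first position where it does so.  This partitions
the words, apart from those that avoid the image of [g], into sets in which one
letter ranges over the image of [g] and the others are fixed, and the uniform
measure of the cube is uniform on each of them.  The words that avoid the image
have density [(1 - #|T1| / #|T2|) ^ b] in dimension [b]. *)
Lemma sample_letter T1 T2 (e : R) : (0 < #|T1|)%N -> 0 < e ->
  exists I, forall g : T1 -> T2, injective g ->
  forall (F : word I T2 -> R) (v : R), (forall x, F x <= 1) -> 0 <= v ->
    (forall c : subsp I unit T2, nondeg c ->
       mean (fun a => F (sapply c [ffun => g a])) <= v) ->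
    mean F <= v + e.
Proof.
move=> T1_gt0 e0.
have [nle|le12] := ltnP #|T2| #|T1|.
  by exists void => g /leq_card; rewrite leqNgt nle.
have T2_gt0 : (0 < #|T2|)%N := leq_trans T1_gt0 le12.
have T2n0 : #|T2|%:R != 0 :> R by rewrite pnatr_eq0 -lt0n.
pose k : R := #|T1|%:R / #|T2|%:R.
have k01 : 0 < k <= 1.
  by rewrite divr_gt0 ?ltr0n//= ler_pdivrMr ?ltr0n// mul1r ler_nat.
have [b Hb] : exists s, (1 - k) ^+ s <= e by apply: exp_small => //; lra.
(* [(1 - k) ^+ b] is the density of the words that avoid the image of [g]. *)
suff [I HI] : exists I, forall g : T1 -> T2, injective g ->
  forall (F : word I T2 -> R) (v : R), (forall x, F x <= 1) -> 0 <= v ->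
    (forall c : subsp I unit T2, nondeg c ->
       mean (fun a => F (sapply c [ffun => g a])) <= v) ->
    mean F <= v + (1 - k) ^+ b.
  exists I => g ig F v F1 v0 /(HI _ ig _ _ F1 v0) /le_trans; apply; lra.
elim: b {Hb} => [|b [I IH]].
  exists void => g _ F v F1 v0 _; rewrite expr0.
  by apply: mean_le => [|x]; [lra|have := F1 x; lra].
exists (option I) => g ig F v F1 v0 Fv.
rewrite mean_wcons /mean.
set S : {set T2} := imset g (mem T1).
have cS : #|S| = #|T1| by rewrite card_imset.
rewrite (bigID (mem S))/=.
have -> : \sum_(a in S) mean (fun x => F (wcons a x)) =
   \sum_(a : T1) mean (fun x => F (wcons (g a) x)).
  by rewrite big_imset//= => x y _ _; exact: ig.
have H1 : \sum_(a : T1) mean (fun x => F (wcons (g a) x)) <= #|T1|%:R * v.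
  rewrite -ler_pdivrMl ?ltr0n// mulrC -/(mean _) mean_exchange.
  apply: mean_le => // x.
  apply: le_trans (Fv (letter_subsp x) _).
    rewrite le_eqVlt; apply/orP; left; apply/eqP; apply: eq_mean => a.
    by congr F; apply/ffunP => -[i|]; rewrite !ffunE.
  by apply/nondegP => -[]; exists None; rewrite ffunE.
have H2 : \sum_(a | a \notin S) mean (fun x => F (wcons a x)) <=
          (#|T2|%:R - #|T1|%:R) * (v + (1 - k) ^+ b).
  rewrite (_ : #|T2|%:R - #|T1|%:R = #|[predC S]|%:R :> R); last first.
    by rewrite -(cardC S) cS natrD addrAC subrr add0r.
  rewrite mulr_natl -sumr_const; apply: ler_sum => a aS.
  apply: (IH _ ig _ _ _ v0) => // c nc.
  apply: le_trans (Fv (wcons (inl a) c) _).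
    rewrite le_eqVlt; apply/orP; left; apply/eqP; apply: eq_mean => b'.
    by congr F; apply/ffunP => -[i|]; rewrite !ffunE.
  have /nondegP nc' := nc; apply/nondegP => j; have [i ci] := nc' j.
  by exists (Some i); rewrite ffunE.
rewrite ler_pdivrMr ?ltr0n//.
have kE : #|T1|%:R = k * #|T2|%:R by rewrite /k divfK.
move: H1 H2; rewrite exprS kE.
set n2 := #|T2|%:R; set r := (1 - k) ^+ b => H1 H2.
lra.
Qed.

(** A function on a large cube over [T2] has almost its mean on some subspace
whose wildcards range over the image of [g] only.  This replaces a comparison
between the uniform measures over two alphabets, which are far apart in high
dimension.  The dimension is chosen before [g], and the conclusion is stated
contrapositively, as a bound for the mean over the cube. *)
Lemma sampling T1 T2 J (e : R) : (0 < #|T1|)%N -> 0 < e ->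
  exists I, forall g : T1 -> T2, injective g ->
  forall (F : word I T2 -> R) (v : R), (forall x, F x <= 1) -> 0 <= v ->
    (forall c : subsp I J T2, nondeg c ->
       mean (fun u : word J T1 => F (sapply c (wmap g u))) <= v) ->
    mean F <= v + e.
Proof.
move=> T10; move: J e; apply: finType_ind => [J J' h bh IH e e0||J IH e e0].
- have [I HI] := IH e e0; exists I => g ig F v F1 v0 Fv.
  apply: (HI _ ig _ _ F1 v0) => c nc.
  apply: le_trans (Fv (sren h c) (nondeg_ren bh nc)).
  have [h' hh' h'h] := bh.
  have bij : bijective (fun u : word J' T1 => [ffun j => u (h j)] : word J T1).
    exists (fun u : word J T1 => [ffun j => u (h' j)] : word J' T1) => u;
      by apply/ffunP => j; rewrite !ffunE ?hh' ?h'h.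
  rewrite (mean_bij _ bij) le_eqVlt; apply/orP; left; apply/eqP.
  apply: eq_mean => u /=; rewrite sapply_ren; congr (F (sapply _ _)).
  by apply/ffunP => j; rewrite !ffunE.
- move=> e e0; exists void => g ig F v F1 v0 /(_ _ (nondeg_id _ _)) Fv.
  suff -> : mean F = mean (fun u => F (sapply (sid void T2) (wmap g u))) by lra.
  have w0 (T : finType) : word void T by apply: finfun => -[].
  have wE (T : finType) (w : word void T) : w = w0 T by apply/ffunP => -[].
  transitivity (F (w0 T2)).
    by rewrite -[RHS](mean_cst (w0 T2)); apply: eq_mean => w; congr F; exact: wE.
  by rewrite -[LHS](mean_cst (w0 T1)); apply: eq_mean => w; congr F; exact/esym/wE.
have [I1 HI1] := @sample_letter T1 T2 (e / 2) T10 ltac:(lra).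
have [I2 HI2] := IH (e / 2) ltac:(lra).
exists (I1 + I2)%type => g ig F v F1 v0 Fv.
suff : mean F <= (v + e / 2) + e / 2 by lra.
rewrite mean_wcat.
apply: (HI1 _ ig); [|lra|].
  by move=> x; apply: mean_le.
move=> c1 nc1; rewrite mean_exchange.
apply: (HI2 _ ig _ _ _ v0).
  by move=> x; apply: mean_le.
move=> c2 nc2.
pose c : subsp (I1 + I2)%type (option J) T2 :=
  sren (fun s : unit + J => match s with inl _ => None | inr j => Some j end)
    (scat c1 c2).
have bh : bijective
    (fun s : unit + J => match s with inl _ => None | inr j => Some j end).
  by exists (fun o : option J => if o is Some j then inr j else inl tt);
    [case=> [[]|j]|case].
have nc : nondeg c by apply: nondeg_ren bh _; exact: nondeg_cat.
apply: le_trans (Fv c nc).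
rewrite mean_wcons mean_exchange /= le_eqVlt; apply/orP; left; apply/eqP.
apply: eq_mean => u; apply: eq_mean => a.
rewrite /c sapply_ren; congr F.
rewrite -sapply_cat; congr (sapply _ _).
by apply/ffunP => -[[]|j]; rewrite !ffunE.
Qed.

(** * Insensitive sets *)

Definition collapse I T (r : T) (u : word I (option T)) : word I (option T) :=
  wmap Some (fill u r).

(** Invariance under the replacement of all the letters [None] by [Some r] is the
same as invariance under arbitrary exchanges of these two letters. *)
Definition insens I T (r : T) (D : word I (option T) -> bool) : Prop :=
  forall u, D (collapse r u) = D u.

Lemma collapse_cat I J T (r : T) (u : word I (option T)) (v : word J (option T)) :
  collapse r (wcat u v) = wcat (collapse r u) (collapse r v).
Proof. by apply/ffunP => -[i|i]; rewrite !ffunE. Qed.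

Lemma collapse_sapply I J T (r : T) (f : subsp I J (option T)) u :
  collapse r (sapply f (collapse r u)) = collapse r (sapply f u).
Proof. by apply/ffunP => i; rewrite !ffunE; case: (f i) => // j; rewrite !ffunE. Qed.

Lemma collapseK I T (r : T) (u : word I (option T)) :
  collapse r (collapse r u) = collapse r u.
Proof. by apply/ffunP => i; rewrite !ffunE. Qed.

Lemma insens_sapply I J T (r : T) (f : subsp I J (option T)) D :
  insens r D -> insens r (D \o sapply f).
Proof. by move=> iD u; rewrite /= -iD collapse_sapply iD. Qed.

Lemma insens_wcatr I J T (r : T) (x : word I (option T))
    (D : word (I + J)%type (option T) -> bool) :
  insens r D -> insens r (fun y => D (wcat x y)).
Proof. by move=> iD y; rewrite -iD collapse_cat collapseK -collapse_cat iD. Qed.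

(** Sampling finds a subspace on which [D] is dense already among the words over
[T]; the theorem for [T] finds a smaller subspace all of whose words over [T]
are in [D], and by insensitivity the words with the letter [None] are in [D] as
well. *)
Lemma insens_subsp T (r : T) J (d : R) : DHJ T -> 0 < d ->
  exists I, forall D : word I (option T) -> bool, insens r D -> d <= density D ->
    exists2 f : subsp I J (option T), nondeg f & forall w, D (sapply f w).
Proof.
move=> dhj d0.
have [I0 HI0] := DHJ_MDHJ dhj J (d := d / 2) ltac:(lra).
have T0 : (0 < #|T|)%N by apply/card_gt0P; exists r.
have [I HI] := @sampling T (option T) I0 (d / 3) T0 ltac:(lra).
exists I => D iD dD.
have [c nc Hc] : exists2 c : subsp I I0 (option T), nondeg c &
    d / 2 <= density (fun u : word I0 T => D (sapply c (wmap Some u))).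
  apply: contrapT => nex.
  suff : density D <= d / 2 + d / 3 by lra.
  apply: (HI _ Some_inj); [by move=> x; rewrite lern1 leq_b1|lra|].
  move=> c nc; rewrite leNgt; apply/negP => H; apply: nex; exists c => //.
  exact: ltW.
have [f nf Hf] := HI0 _ Hc.
pose f' : subsp I0 J (option T) :=
  [ffun i => match f i with inl a => inl (Some a) | inr j => inr j end].
exists (scomp c f').
  apply: nondeg_comp => //; have /nondegP nf' := nf.
  by apply/nondegP => j; have [i fi] := nf' j; exists i; rewrite ffunE fi.
move=> w; rewrite sapply_comp -iD -collapse_sapply iD.
have -> // : collapse r (sapply f' w) = wmap Some (sapply f (fill w r)).
by apply/ffunP => i; rewrite !ffunE; case: (f i) => // j; rewrite ffunE.
Qed.

Lemma mean_imset (X Y : finType) (h : X -> Y) (g : Y -> R) : injective h ->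
  mean (fun y => g y * (y \in imset h (mem X))%:R) =
  #|X|%:R / #|Y|%:R * mean (g \o h).
Proof.
move=> ih; rewrite /mean.
have -> : \sum_y g y * (y \in imset h (mem X))%:R = \sum_x g (h x).
  rewrite -(big_imset g)/=; last by move=> x y _ _; exact: ih.
  rewrite [RHS]big_mkcond; apply: eq_bigr => y _.
  by case: ifP => _; rewrite ?mulr1 ?mulr0.
have [X0|X0] := posnP #|X|.
  by rewrite X0 !mul0r big_pred0 ?mul0r// => x; have := card0_eq X0 x.
have Xn0 : #|X|%:R != 0 :> R by rewrite pnatr_eq0 -lt0n.
by rewrite [RHS]mulrC mulrA divfK.
Qed.

Definition nonpos_on I J T (w : word I T -> R) : Prop :=
  forall f : subsp I J T, nondeg f -> mean (w \o sapply f) <= 0.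

(** An insensitive set is, up to a small error, a disjoint union of subspaces
with wildcards [J].  This is expressed through a weight [w <= 1] whose mean on
each such subspace is nonpositive: its integral over the set is almost
nonpositive.  In this form neither the family of subspaces nor its
disjointness has to be mentioned.

As long as [D] has density larger than [b], many of its fibres contain a
subspace by [insens_subsp], and the same subspace [f] serves for a set [S] of
them of density bounded below.  Remove the product of [f] and [S] from [D].
Since [S] is insensitive, so is each fibre of the rest over the first factor,
and the argument continues there, in the remaining coordinates.  Each round
multiplies the density of what is left by at most [1 - k]. *)
Lemma tiling T (r : T) J (e : R) : DHJ T -> 0 < e ->
  exists I, forall w : word I (option T) -> R,
    (forall x, w x <= 1) -> nonpos_on J w ->
    forall D, insens r D -> mean (fun x => w x * (D x)%:R) <= e.
Proof.
move=> dhj e0.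
pose b := e / 2.
have b0 : 0 < b by rewrite /b; lra.
have [I0 HI0] := insens_subsp r J (d := b / 2) dhj ltac:(lra).
pose X : finType := word J (option T).
pose Y : finType := word I0 (option T).
pose Z : finType := subsp I0 J (option T).
pose x0 : X := [ffun=> None]. pose y0 : Y := [ffun=> None].
pose z0 : Z := [ffun=> inl None].
have X0 : 0 < #|X|%:R :> R by rewrite ltr0n; apply/card_gt0P; exists x0.
have Y0 : 0 < #|Y|%:R :> R by rewrite ltr0n; apply/card_gt0P; exists y0.
have Z0 : 0 < #|Z|%:R :> R by rewrite ltr0n; apply/card_gt0P; exists z0.
(* [t] is a lower bound for the density of what one round removes.  It is
   lowered to [k] in order to be less than 1. *)
pose t := #|X|%:R / #|Y|%:R * (b / 2 / #|Z|%:R).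
have t0 : 0 < t by rewrite /t !(mulr_gt0, divr_gt0, invr_gt0)//; lra.
pose k := t / (1 + t).
have k01 : 0 < k < 1.
  by rewrite divr_gt0/= ?ltr_pdivrMr ?mul1r; lra.
have kt : k <= t.
  rewrite ler_pdivrMr; last lra.
  by rewrite ler_peMr; lra.
have [s Hs] : exists s, (1 - k) ^+ s <= b by apply: exp_small => //; lra.
suff [I HI] : exists I, forall w : word I (option T) -> R,
    (forall x, w x <= 1) -> nonpos_on J w ->
    forall D, insens r D ->
      mean (fun x => w x * (D x)%:R) <= b + (1 - k) ^+ s * density D.
  exists I => w w1 wJ D iD; apply: le_trans (HI w w1 wJ D iD) _.
  have := density_le1 D; have := density_ge0 D.
  have : 0 <= (1 - k) ^+ s by apply: exprn_ge0; lra.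
  move: Hs; rewrite /b; set q := (1 - k) ^+ s; set dd := density D; nra.
elim: s {Hs} => [|s [Is IH]].
  exists void => w w1 _ D _; rewrite expr0 mul1r.
  have : mean (fun x => w x * (D x)%:R) <= density D.
    by apply: ler_mean => x; have := w1 x; case: (D x); rewrite ?mulr1 ?mulr0.
  by move: b0; lra.
exists (I0 + Is)%type => w w1 wJ D iD.
have q0 : 0 <= (1 - k) ^+ s by apply: exprn_ge0; lra.
have [Db|bD] := leP (density D) b.
  have : mean (fun x => w x * (D x)%:R) <= density D.
    by apply: ler_mean => x; have := w1 x; case: (D x); rewrite ?mulr1 ?mulr0.
  have : 0 <= (1 - k) ^+ s.+1 * density D.
    by rewrite mulr_ge0 ?density_ge0// exprn_ge0//; lra.
  by lra.
have dD' : b <= mean (fun y : word Is _ => density (fun x : Y => D (wcat x y))).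
  by apply: ltW; move: bD; rewrite /density mean_wcat mean_exchange.
have [|y dy|_ [f Hf]] := @mean_pigeonhole _ Z _
    (fun (f : Z) y => nondeg f && [forall u, D (wcat (sapply f u) y)])
    b b0 _ dD'.
- by move=> y; exact: density_le1.
- have [|f nf Hf] := HI0 (fun x => D (wcat x y)) _ dy.
    by move=> u; rewrite -iD collapse_cat collapseK -collapse_cat iD.
  by exists f; rewrite nf /=; apply/forallP.
have nf : nondeg f.
  have [|y /andP[]//] := mean_gt0_ex (lt_le_trans _ Hf).
  by rewrite divr_gt0//; lra.
move: Hf; rewrite nf /=.
set S := fun y => [forall u, D (wcat (sapply f u) y)].
rewrite -/(density S) => Hf.
pose V := imset (sapply f) (mem X).
have iV := sapply_inj nf.
have iS : insens r S.
  move=> y; apply/forallP/forallP => H u; have := H u;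
    by rewrite -iD -[in X in _ -> X]iD !collapse_cat collapseK.
(* What is left of [D] when the copy of [f] over each [y] in [S] is removed. *)
pose D' x y := D (wcat x y) && ~~ ((x \in V) && S y).
have DE x y : (D (wcat x y))%:R = (S y)%:R * (x \in V)%:R + (D' x y)%:R :> R.
  rewrite /D'; case xV: (x \in V) => /=; last first.
    by rewrite andbT mulr0 add0r.
  case Sy: (S y) => /=; last by rewrite andbT mul0r add0r.
  rewrite andbF mulr1 addr0; case/imsetP: xV => u _ ->.
  by have /forallP -> := Sy.
have iD' x : insens r (D' x).
  by move=> y; rewrite /D' iS (insens_wcatr x iD).
pose dV : R := #|X|%:R / #|Y|%:R.
have dD'E : mean (fun x => density (D' x)) = density D - dV * density S.
  rewrite {2}/density mean_wcat.
  under [X in _ = X - _]eq_mean => x do under eq_mean => y do rewrite DE.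
  under [X in _ = X - _]eq_mean => x do rewrite meanD.
  rewrite meanD -/(density _) [X in _ = X + _ - _]mean_exchange.
  suff -> : mean (fun y => mean (fun x => (S y)%:R * (x \in V)%:R)) = dV * density S.
    by rewrite addrAC subrr add0r.
  under eq_mean => y do
    rewrite (mean_imset (fun=> (S y)%:R) iV) /comp (mean_cst x0).
  by rewrite meanZ.
rewrite mean_wcat.
under eq_mean => x do under eq_mean => y do rewrite DE mulrDr.
under eq_mean => x do rewrite meanD.
rewrite meanD.
(* The removed part is a union of subspaces, where [w] has mean at most 0. *)
have H1 : mean (fun x => mean (fun y =>
    w (wcat x y) * ((S y)%:R * (x \in V)%:R))) <= 0.
  rewrite mean_exchange; apply: mean_le => // y.
  under eq_mean => x do rewrite mulrA.
  rewrite (mean_imset (fun x => w (wcat x y) * (S y)%:R) iV).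
  apply: mulr_ge0_le0; first by rewrite divr_ge0 ?ler0n.
  case: (S y); last by apply: mean_le => // u /=; rewrite mulr0.
  under eq_mean => u do rewrite /= mulr1 -sapply_catr.
  by apply: wJ; exact: nondeg_catr.
have H2 : mean (fun x => mean (fun y => w (wcat x y) * (D' x y)%:R)) <=
          b + (1 - k) ^+ s * mean (fun x => density (D' x)).
  rewrite -meanZ -[X in X + _](mean_cst y0) -meanD.
  apply: ler_mean => x; apply: IH => //.
  move=> g ng /=; have := wJ _ (nondeg_catl x ng).
  by under eq_mean => u do rewrite /= sapply_catl.
apply: le_trans (lerD H1 H2) _.
rewrite add0r lerD2l exprSr -mulrA; apply: ler_wpM2l => //.
rewrite dD'E mulrBl mul1r lerD2l lerN2.
have dV0 : 0 < dV by rewrite divr_gt0.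
apply: (@le_trans _ _ t).
  have := density_le1 D; have := density_ge0 D.
  by set dd := density D; nra.
by rewrite /t -/dV ler_pM2l.
Qed.

(** For [E r :|: E'], where [E'] is the union over the rest of the list, the
part [E r] and its complement are both insensitive.  They are tiled by subspaces
of a dimension in which the assertion holds for [w] and for [w] restricted to
[E'], respectively, so that these weights, lowered by [e / 4], satisfy the
hypothesis of [tiling].  The bound on the mean of [w] itself is what the
induction needs for the part [E r]. *)
Lemma union_tiling T (s : seq T) J (e : R) : DHJ T -> 0 < e ->
  exists I, forall w : word I (option T) -> R,
    (forall x, w x <= 1) -> nonpos_on J w ->
    forall E : T -> word I (option T) -> bool, (forall r, insens r (E r)) ->
    mean w <= e /\ mean (fun x => w x * (has (E^~ x) s)%:R) <= e.
Proof.
move=> dhj; elim: s J e => [|r s IH] J e e0.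
  exists J => w w1 /(_ _ (nondeg_id _ _)) wJ E iE; split.
    move: wJ; rewrite (@eq_mean _ _ w); first lra.
    by move=> x /=; rewrite sapply_id.
  by apply: mean_le => [|x]; rewrite ?mulr0; exact: ltW.
have e4 : 0 < e / 4 by lra.
have [J' HJ'] := IH J _ e4.
have [I HI] := tiling r J' dhj e4.
exists I => w w1 wJ E iE.
have wJ' f : nondeg f ->
    mean (w \o sapply f) <= e / 4 /\
    mean (fun u : word J' _ =>
      w (sapply f u) * (has (E^~ (sapply f u)) s)%:R) <= e / 4.
  move=> nf; apply: (HJ' (w \o sapply f) _ _ (fun r => E r \o sapply f)).
  - by move=> x; exact: w1.
  - move=> g ng; have := wJ _ (nondeg_comp nf ng).
    by under eq_mean => u do rewrite /= sapply_comp.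
  - by move=> q; exact: insens_sapply.
have u0 : word J' (option T) by exact: [ffun=> None].
have x0 : word I (option T) by exact: [ffun=> None].
pose w1' x := w x - e / 4.
pose w2' x := w x * (has (E^~ x) s)%:R - e / 4.
have H1 D : insens r D -> mean (fun x => w1' x * (D x)%:R) <= e / 4.
  apply: HI => [x|f nf]; first by rewrite /w1'; have := w1 x; lra.
  by rewrite /comp /w1' meanB (mean_cst u0) subr_le0; case: (wJ' _ nf).
have H2 D : insens r D -> mean (fun x => w2' x * (D x)%:R) <= e / 4.
  apply: HI => [x|f nf].
    by rewrite /w2'; have := w1 x; case: has; rewrite ?mulr1 ?mulr0; lra.
  by rewrite /comp /w2' meanB (mean_cst u0) subr_le0; case: (wJ' _ nf).
split.
  have := H1 (fun=> true) (fun=> erefl).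
  under eq_mean => x do rewrite mulr1.
  by rewrite /w1' meanB (mean_cst x0); lra.
have HE := H1 _ (iE r).
have HNE : mean (fun x => w2' x * (~~ E r x)%:R) <= e / 4.
  by apply: H2 => x; rewrite iE.
have : mean (fun x => w x * (has (E^~ x) (r :: s))%:R) <=
       mean (fun x => w1' x * (E r x)%:R + w2' x * (~~ E r x)%:R + e / 4).
  apply: ler_mean => x; rewrite /w1' /w2' /=.
  by case: (E r x); rewrite /= ?mulr1 ?mulr0; lra.
by rewrite !meanD (mean_cst x0); lra.
Qed.

(** * From the alphabet T to the alphabet option T *)

(** [D] is the supremum of the densities that line-free sets attain in every
dimension.  At the supremum one density increment is a contradiction already,
so that increments need not be iterated. *)
Lemma critical_density T (d : R) : 0 < d ->
  ~ (exists I, forall A : word I T -> bool, d <= density A ->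
       exists2 L, pattern L & forall a, A (fill L a)) ->
  exists D : R, [/\ 0 < D, D <= 1,
    forall e : R, 0 < e -> exists I, forall A : word I T -> bool,
      line_free A -> density A <= D + e &
    forall e : R, 0 < e -> forall I, exists2 A : word I T -> bool,
      line_free A & D - e <= density A].
Proof.
move=> d0 nI.
pose S : set R := [set c | forall I, exists2 A : word I T -> bool,
  line_free A & c <= density A].
have Sd : S d.
  move=> I; apply: contrapT => nA; apply: nI; exists I => A dA.
  apply: contrapT => nL; apply: nA; exists A => // L pL.
  apply: contrapT => na; apply: nL; exists L => // a.
  by apply: contrapT => nAa; apply: na; exists a; apply/negP.
have S1 : ubound S 1.
  by move=> c /(_ void)[A _ /le_trans]; apply; exact: density_le1.
have hS : has_sup S by split; [exists d|exists 1].
exists (sup S); split.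
- by apply: (lt_le_trans d0); exact: sup_upper_bound.
- by apply: ge_sup => //; exists d.
- move=> e e0; apply: contrapT => nE.
  suff /(sup_upper_bound hS) : S (sup S + e) by lra.
  move=> I; apply: contrapT => nA; apply: nE; exists I => A lA.
  by rewrite leNgt; apply/negP => /ltW ?; apply: nA; exists A.
- move=> e e0 I; have [c Sc ec] := sup_adherent e0 hS.
  have [A lA cA] := Sc I; exists A => //.
  by apply: le_trans cA; exact: ltW.
Qed.

(** If no fibre exceeds the mean by much, then no fibre is far below it, with a
loss proportional to the number of fibres.  The point is that this holds for
every single fibre, so that [A] stays dense over any chosen part of the cube,
no matter how small. *)
Lemma fibre_density I J T (A : word (I + J)%type T -> bool) (D e : R) :
    (forall x, density (fun y => A (wcat x y)) <= D + e) ->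
    D - e <= density A -> 0 <= e ->
  forall x, D - (2 * #|word I T|%:R) * e <= density (fun y => A (wcat x y)).
Proof.
move=> Ax DA e0 x.
have N0 : 0 < #|word I T|%:R :> R by rewrite ltr0n; apply/card_gt0P; exists x.
move: DA; rewrite {1}/density mean_wcat {1}/mean ler_pdivlMr// (bigD1 x)//=.
have : \sum_(i | i != x) mean (fun y => (A (wcat i y))%:R) <=
       \sum_(i : word I T | i != x) (D + e).
  by apply: ler_sum => i _; exact: Ax.
have cE : #|word I T|.-1%:R = #|word I T|%:R - 1 :> R.
  by rewrite -subn1 natrB// -(ltr0n R).
rewrite sumr_const (cardC1 x) -[X in _ <= X -> _]mulr_natr cE.
rewrite -/(density _).
set N := #|word I T|%:R in N0 *; set s := \sum_(i | _) _; set a := density _.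
nra.
Qed.

(** The constants are chosen in the following order.  [t] is a lower bound for
the density of the good patterns, from the theorem for [T]; [e] is the error
allowed for the density of line-free sets; [J] is a dimension in which unions
of insensitive sets can be tiled with error [e]; [I] is a dimension from which
a [J]-dimensional cube of patterns can be sampled; [e1] is an error so small
that all fibres over [II] have density within [e] of [D]. *)
Lemma DHJ_step T : (0 < #|T|)%N -> DHJ T -> DHJ (option T).
Proof.
move=> T0 dhj d d0; apply: contrapT => /(critical_density d0)[D [D0 D1 Dub Dlb]].
have [I1 HI1] := dhj (D / 2 / 2) ltac:(lra).
pose Z : finType := word I1 (option T).
pose z0 : Z := [ffun=> None].
have Z0 : 0 < #|Z|%:R :> R by rewrite ltr0n; apply/card_gt0P; exists z0.
have Z1 : 1 <= #|Z|%:R :> R by rewrite ler1n -(ltr0n R).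
pose t := D / 2 / 2 / #|Z|%:R.
have t0 : 0 < t by rewrite divr_gt0//; lra.
have tD : t <= D / 2 / 2 by rewrite /t ler_pdivrMr// ler_peMr; lra.
pose e := D * t / 16.
have e0 : 0 < e by rewrite /e; nra.
have eD : e <= D / 16 by rewrite /e; nra.
have [J0 HJ0] := Dub e e0.
have [J HJ] := union_tiling (enum T) J0 dhj e0.
have oT0 : (0 < #|{: option T}|)%N by rewrite card_option.
have [I HI] := @sampling (option T) (T + I1)%type J (t / 2) oT0 ltac:(lra).
(* The second summand repeats the parameters of a subspace once, so that the
   patterns below have a wildcard even if the sampled part has none. *)
pose II : finType := (I + I1)%type.
pose N : R := #|word II (option T)|%:R.
have N0 : 0 < N by rewrite ltr0n; apply/card_gt0P; exists [ffun=> None].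
pose e1 := e / (2 * N).
have e10 : 0 < e1 by rewrite divr_gt0//; lra.
have [J1 HJ1] := Dub e1 e10.
have [A lA DA] := Dlb e1 e10 (II + J1)%type.
have Afib y : D - e <= density (fun x => A (wcat y x)).
  have := @fibre_density _ _ _ A D e1 _ DA (ltW e10) y.
  rewrite -/N (_ : 2 * N * e1 = e); last by rewrite /e1 mulrC divfK; nra.
  apply => x; apply: HJ1.
  have := line_free_sapply (nondeg_catl x (nondeg_id J1 _)) lA.
  congr line_free; apply/funext => u /=.
  by rewrite sapply_catl sapply_id.
(* A word [u] over [T + I1] is a subspace with wildcards [I1]; its points are
   taken as words over [option T] that avoid [None]. *)
pose point (u : subsp I I1 T) (y : word I1 T) : word II (option T) :=
  wmap Some (wcat (sapply u y) y).
pose Y : finType := (subsp I I1 T * word J1 (option T))%type.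
pose good (v : Z) (p : Y) :=
  pattern v && [forall a, A (wcat (point p.1 (fill v a)) p.2)].
have [||v Hv|_ [v Hv]] := @mean_pigeonhole Y Z
  (fun p => density (fun y => A (wcat (point p.1 y) p.2))) good (D / 2) ltac:(lra).
- by move=> p; exact: density_le1.
- rewrite /density mean_exchange.
  have /card_gt0P[a0 _] := T0.
  apply: (mean_ge [ffun=> a0]) => y.
  rewrite mean_pair; apply: (mean_ge [ffun=> inl a0]) => u.
  by apply: (@le_trans _ _ (D - e)); [lra|exact: (Afib (point u y))].
- have [L pL LA] := HI1 _ Hv; exists L; rewrite /good pL /=.
  by apply/forallP.
rewrite -/t in Hv.
have pv : pattern v.
  have [p /andP[]//] := mean_gt0_ex (lt_le_trans t0 Hv).
have /patternP[i1 vi1] := pv.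
(* Restricting the subspace [u] to the line [v] yields a pattern, which is the
   image of the letters of [u] under [pi].  The section [g] of [pi] tells which
   letters of [u] to sample in order to get all patterns in some cube. *)
pose pi (k : T + I1) : option T :=
  match k with inl a => Some a | inr j => v j end.
pose g (o : option T) : T + I1 := if o is Some a then inl a else inr i1.
have gK : cancel g pi by case.
pose F (u : word I (T + I1)%type) : R := density (fun x => good v (u, x)).
have mF : t <= mean F by move: Hv; rewrite mean_pair.
have [c nc Hc] : exists2 c : subsp I J (T + I1)%type, nondeg c &
    t / 4 <= mean (fun w : word J (option T) => F (sapply c (wmap g w))).
  apply: contrapT => nex.
  suff : mean F <= t / 4 + t / 2 by lra.
  apply: (HI _ (can_inj gK)); [by move=> x; exact: density_le1|lra|].
  move=> c nc; rewrite leNgt; apply/negP => H; apply: nex; exists c => //.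
  exact: ltW.
(* The cube of patterns: the image of the sampled subspace [c] under [pi],
   followed by a fixed copy of [v], which contains [None] at [i1]. *)
pose f : subsp II J (option T) :=
  [ffun s => match s with
     | inl i => match c i with inl k => inl (pi k) | inr j => inr j end
     | inr i => inl (v i) end].
have nf : nondeg f.
  have /nondegP nc' := nc; apply/nondegP => j; have [i ci] := nc' j.
  by exists (inl i); rewrite ffunE ci.
have patf w : pattern (sapply f w).
  by apply/patternP; exists (inr i1); rewrite !ffunE.
have pointE w a :
    point (sapply c (wmap g w)) (fill v a) = collapse a (sapply f w).
  apply/ffunP => -[i|i]; rewrite !ffunE //=.
  case: (c i) => [[b|j]|j]; rewrite ?ffunE //=.
  by case: (w j) => //=; rewrite ffunE vi1.
(* [B x] is the fibre of [A] on the cube of patterns, and [E x a] is the set of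
   patterns whose point at [a] is not in [A]. *)
pose B x w := A (wcat (sapply f w) x).
pose E x a w := ~~ A (wcat (collapse a (sapply f w)) x).
have iE x a : insens a (E x a).
  by move=> w; rewrite /E collapse_sapply.
(* A pattern [w] in [B x] outside of all the [E x a] would give a line in [A]:
   let the wildcards of [w] range over [option T], with [w] as its last point. *)
have cover x w : B x w -> has (E x ^~ w) (enum T).
  move=> Bxw.
  pose L : word (II + J1)%type (option (option T)) :=
    [ffun s => match s with
      | inl i => if sapply f w i is Some b then Some (Some b) else None
      | inr j => Some (x j) end].
  have pL : pattern L.
    have /patternP[i fi] := patf w.
    by apply/patternP; exists (inl i); rewrite ffunE fi.
  have [[a|]] := lA L pL; last first.
    rewrite (_ : fill L None = wcat (sapply f w) x) => [/negP//|].
    by rewrite /L; move: (sapply f w) => h; apply/ffunP => -[i|j];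
      rewrite !ffunE//=; case: (h i).
  rewrite (_ : fill L (Some a) = wcat (collapse a (sapply f w)) x) => [EA|].
    by apply/hasP; exists a; rewrite ?mem_enum.
  by rewrite /L; move: (sapply f w) => h; apply/ffunP => -[i|j];
      rewrite !ffunE//=; case: (h i).
pose U x w := has (E x ^~ w) (enum T).
(* [union_tiling] for the weight [B x - (D + e)], which is nonpositive on
   subspaces since [A] is line-free. *)
have key x : density (B x) <= (D + e) * density (U x) + e.
  pose w x' : R := (B x x')%:R - (D + e).
  have [|f' nf'|_ H] := HJ w _ _ (E x) (iE x).
  - by move=> z; rewrite /w; have : (B x z)%:R <= 1 :> R by [rewrite lern1 leq_b1]; lra.
  - rewrite /comp /w meanB (mean_cst [ffun=> None]) subr_le0.
    apply: HJ0; have := line_free_sapply (nondeg_catr x (nondeg_comp nf nf')) lA.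
    congr line_free; apply/funext => u /=.
    by rewrite sapply_catr sapply_comp.
  move: H; rewrite -/(U x).
  have -> : mean (fun z => w z * (has (E x ^~ z) (enum T))%:R) =
            density (B x) - (D + e) * density (U x).
    rewrite -meanZ -meanB; apply: eq_mean => z; rewrite /w mulrBl; congr (_ - _).
    rewrite -natrM mulnb; congr (nat_of_bool _)%:R.
    by apply: andb_idr; exact: cover.
  lra.
have UE x : density (U x) =
    1 - density (fun w => good v (sapply c (wmap g w), x)).
  rewrite -[X in X - _](mean_cst ([ffun=> None] : word J (option T))) -meanB.
  apply: eq_mean => w.
  suff -> : U x w = ~~ good v (sapply c (wmap g w), x).
    by case: (good _ _); rewrite ?subrr ?subr0.
  rewrite /U -[LHS]negbK -all_predC /good pv; congr (~~ _).
  apply/allP/forallP => [H a|H a _].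
    by have := H a; rewrite mem_enum /E /= negbK pointE; apply.
  by rewrite /E /= negbK -pointE.
have : mean (fun x => density (B x)) <= (D + e) * (1 - t / 4) + e.
  apply: (le_trans (ler_mean key)).
  rewrite meanD (mean_cst [ffun=> None]) meanZ lerD2r ler_pM2l; last lra.
  under eq_mean => x do rewrite UE.
  rewrite meanB (mean_cst [ffun=> None]) lerD2l lerN2.
  by move: Hc; rewrite /F /density mean_exchange.
have : D - e <= mean (fun x => density (B x)).
  rewrite mean_exchange.
  by apply: (mean_ge [ffun=> None]) => w; exact: Afib.
rewrite /e; nra.
Qed.

(** * The density Hales-Jewett theorem *)

Lemma wmap_bij I T T' (h : T -> T') : bijective h -> bijective (@wmap I T T' h).
Proof.
move=> [g hg gh].
by exists (wmap g) => w; apply/ffunP => i; rewrite !ffunE ?hg ?gh.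
Qed.

Lemma DHJ_bij T T' (h : T -> T') : bijective h -> DHJ T -> DHJ T'.
Proof.
move=> bh dhj d d0; have [I HI] := dhj d d0; exists I => A.
rewrite /density (mean_bij _ (@wmap_bij I _ _ _ bh)) => /HI[L /patternP[i Li] LA].
have [g hg gh] := bh.
exists (wmap (omap h) L); first by apply/patternP; exists i; rewrite ffunE Li.
move=> a; have := LA (g a); congr (is_true (A _)).
by apply/ffunP => j; rewrite !ffunE; case: (L j) => //=; rewrite gh.
Qed.

Lemma DHJ_ord k : DHJ 'I_k.+1.
Proof.
elim: k => [|k IH].
  move=> d d0; exists unit => A dA.
  have [x Ax] := mean_gt0_ex (lt_le_trans d0 dA).
  exists [ffun=> None]; first by apply/patternP; exists tt; rewrite ffunE.
  by move=> a; rewrite (_ : fill _ _ = x)//; apply/ffunP => i; rewrite !ord1.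
have := DHJ_step _ IH; rewrite card_ord => /(_ isT).
exact: (DHJ_bij (@option_ord_bij k.+1)).
Qed.

Lemma eq_card_ex_bij (X Y : finType) : #|X| = #|Y| -> exists h : X -> Y, bijective h.
Proof.
move=> e; exists (fun x => enum_val (cast_ord e (enum_rank x))).
exists (fun y => enum_val (cast_ord (esym e) (enum_rank y))) => x.
  by rewrite enum_valK cast_ordK enum_rankK.
by rewrite enum_valK cast_ordKV enum_rankK.
Qed.

Lemma DHJ_large T (d : R) : DHJ T -> 0 < d ->
  exists N, forall n, (N <= n)%N -> forall A : word 'I_n T -> bool,
    d <= density A -> exists2 L, pattern L & forall a, A (fill L a).
Proof.
move=> dhj d0; have [I HI] := dhj (d / 2) ltac:(lra).
exists #|I| => n In A dA.
have [|h [g hg gh]] := @eq_card_ex_bij (I + 'I_(n - #|I|))%type 'I_n.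
  by rewrite card_sum !card_ord subnKC.
pose re (w : word (I + 'I_(n - #|I|))%type T) : word 'I_n T := [ffun i => w (g i)].
have bre : bijective re.
  exists (fun w : word 'I_n T => [ffun s => w (h s)]) => w; apply/ffunP => i;
    by rewrite !ffunE ?gh ?hg.
move: dA; rewrite /density (mean_bij _ bre) mean_wcat mean_exchange => dA.
have [y Hy] : exists y, d / 2 <= density (fun x : word I T => A (re (wcat x y))).
  apply: contrapT => ny; move: dA; rewrite leNgt => /negP; apply.
  apply: (@le_lt_trans _ _ (d / 2)); last lra.
  apply: mean_le => [|y]; first lra.
  by rewrite leNgt; apply/negP => /ltW ?; apply: ny; exists y.
have [L /patternP[i Li] LA] := HI _ Hy.
exists ([ffun j => match g j with inl i => L i | inr j => Some (y j) end]).
  by apply/patternP; exists (h (inl i)); rewrite ffunE hg.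
move=> a; have := LA a; congr (is_true (A _)).
by apply/ffunP => j; rewrite !ffunE; case: (g j) => // ?; rewrite !ffunE.
Qed.

Lemma limn_esup_gt0 (u : nat -> \bar R) : (0 < limn_esup u)%E ->
  exists2 d : R, 0 < d & forall N, exists2 n, (N <= n)%N & (d%:E < u n)%E.
Proof.
move=> u0.
have [d d0 du] : exists2 d : R, 0 < d & (d%:E < limn_esup u)%E.
  case: (limn_esup u) u0 => [r| |//].
    by rewrite lte_fin => r0; exists (r / 2); rewrite ?lte_fin; lra.
  by exists 1 => //; rewrite ltry.
exists d => // N.
have [|_ [n Nn <-] dn] := @ereal_sup_gt _ (u @` [set n | (N <= n)%N]) d%:E.
  apply: (lt_le_trans du); apply: ereal_inf_lbound.
  by exists [set n | (N <= n)%N] => //; exists N.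
by exists n.
Qed.

End DensityHalesJewett.

(** * Digits of rational numbers *)

(** The hypothesis says that a digit [d i] can never make up for the next unit:
by telescoping, the terms below [m] sum to less than [`|c m|], so that the top
digit vanishes.  Then the same holds for the next one, and so on. *)
Lemma mixed_radix_eq0 (c : nat -> rat) (d : nat -> int) (L : nat) :
    (forall i, c i != 0) ->
    (forall i, (i < L)%N -> `|d i|%:~R * `|c i| <= `|c i.+1| - `|c i|) ->
    \sum_(i < L) (d i)%:~R * c i = 0 ->
  forall i, (i < L)%N -> d i = 0.
Proof.
move=> c0; elim: L => [//|L IH] dc.
have bnd m : (m <= L)%N -> `|\sum_(i < m) (d i)%:~R * c i| <= `|c m| - `|c 0%N|.
  elim: m => [|m IHm] mL; first by rewrite big_ord0 normr0 subrr.
  rewrite big_ord_recr /=; apply: (le_trans (ler_normD _ _)).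
  have := IHm (ltnW mL); have := dc m (ltnW mL).
  by rewrite normrM -intr_norm; lra.
rewrite big_ord_recr /= => S0.
have dL : d L = 0.
  have := bnd L (leqnn L); move/eqP: S0; rewrite addr_eq0 => /eqP ->.
  rewrite normrN normrM -intr_norm => H.
  have c00 : 0 < `|c 0%N| by rewrite normr_gt0.
  have cL : 0 < `|c L| by rewrite normr_gt0.
  have : `|d L|%:~R * `|c L| < 1 * `|c L| by lra.
  by rewrite ltr_pM2r// (ltr_int _ _ 1); lia.
move: S0; rewrite dL mul0r addr0 => S0 i; rewrite ltnS leq_eqVlt => /predU1P[->//|iL].
by apply: IH S0 _ iL => j jL; apply: dc; exact: ltnW.
Qed.

(** The indices of the digits in the order of increasing absolute value of the
coefficients: -N, ..., -1, 1, ..., N. *)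
Definition place (N i : nat) : int :=
  if (i < N)%N then - (N - i)%N%:Z else (i - N).+1%:Z.

Definition digit_sum (a : int -> nat) (N : nat) : rat :=
  \sum_(i < N + N) (a (place N i))%:R * rat_coef (place N i).

Lemma norm_rat_coef_neg n : `|rat_coef (- n.+1%:Z)| = ((n.+2)`!%:R)^-1.
Proof.
rewrite /rat_coef oppr_lt0 (_ : `|- n.+1%:Z|%N = n.+1)// ltz_nat /=.
by rewrite normrM normrX normrN1 expr1n mul1r normfV ger0_norm.
Qed.

Lemma norm_rat_coef_pos n : `|rat_coef n.+1%:Z| = (n.+1)`!%:R.
Proof. by rewrite /rat_coef /= normrM normrX normrN1 expr1n mul1r ger0_norm. Qed.

(** The hypothesis of [mixed_radix_eq0] for the coefficients: it comes from
[s / (s + 1)! = 1 / s! - 1 / (s + 1)!] on the negative side and from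
[r r! = (r + 1)! - r!] on the positive side.  At the junction of the two sides
[1 / 1!] and [1!] coincide. *)
Lemma place_bound N i (x : nat) : (x <= `|place N i|)%N ->
  x%:R * `|rat_coef (place N i)| <=
  `|rat_coef (place N i.+1)| - `|rat_coef (place N i)|.
Proof.
rewrite /place => xi.
have [iN|Ni] := ltnP i N; last first.
  rewrite ltnNge (leq_trans Ni) //= subSn // !norm_rat_coef_pos.
  move: xi; rewrite ltnNge Ni /= => xi.
  rewrite (factS (i - N).+1) natrM -[X in _ <= _ - X]mul1r -mulrBl ler_wpM2r//.
  by rewrite -(natr1 (i - N).+1) addrK ler_nat.
have [n Nn] : exists n, (N - i)%N = n.+1 by exists (N - i).-1; lia.
rewrite Nn norm_rat_coef_neg.
have xn : (x <= n.+1)%N by move: xi; rewrite iN; lia.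
have fn : 0 < (n.+1)`!%:R :> rat by rewrite ltr0n fact_gt0.
have xn' : x%:R <= n.+1%:R :> rat by rewrite ler_nat.
have -> : `|rat_coef (if (i.+1 < N)%N then - (N - i.+1)%N%:Z else (i.+1 - N).+1%:Z)|
  = ((n.+1)`!%:R)^-1.
  case: ifP => iN'.
    have -> : (N - i.+1)%N = n.-1.+1 by lia.
    by rewrite norm_rat_coef_neg (_ : n.-1.+2 = n.+1); last lia.
  have -> : (i.+1 - N)%N = 0%N by lia.
  by rewrite norm_rat_coef_pos (_ : n = 0%N) ?invr1; last lia.
have n2 : n.+2%:R = n.+1%:R + 1 :> rat by rewrite natr1.
rewrite factS natrM invfM n2.
set f := (n.+1)`!%:R^-1; have f0 : 0 < f by rewrite invr_gt0.
set m := n.+1%:R in xn' *.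
have m0 : 0 < m + 1 by rewrite /m; have : 0 <= n.+1%:R :> rat by []; lra.
rewrite mulrA -[X in _ <= X - _]mul1r -mulrBl ler_wpM2r//; first exact: ltW.
rewrite -(ler_pM2r m0) mulrBl mulfVK ?mul1r ?gt_eqF//.
rewrite mulVf ?gt_eqF//; lra.
Qed.

Lemma place_surj N (t : int) : t != 0 -> (`|t| <= N)%N ->
  exists2 i, (i < N + N)%N & place N i = t.
Proof.
case: t => [[|n]|n] // _ tN.
  exists (N + n)%N; first by lia.
  by rewrite /place ltnNge leq_addr /= addKn.
exists (N - n.+1)%N; first by lia.
have -> : place N (N - n.+1)%N = - (N - (N - n.+1))%N%:Z.
  by rewrite /place; case: ifP => //; lia.
by rewrite subKn// NegzE.
Qed.

Lemma place_inj N i j : place N i = place N j -> i = j.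
Proof. rewrite /place; case: ifP; case: ifP => ? ? ?; lia. Qed.

Lemma digit_sum_inj a b N :
    (forall t, (a t <= `|t|)%N) -> (forall t, (b t <= `|t|)%N) ->
    digit_sum a N = digit_sum b N ->
  forall t, t != 0 -> (`|t| <= N)%N -> a t = b t.
Proof.
move=> aP bP ab t t0 tN; have [i iN <-] := place_surj t0 tN.
pose d j : int := (a (place N j))%:Z - (b (place N j))%:Z.
suff : d i = 0 by rewrite /d; lia.
apply: (@mixed_radix_eq0 (rat_coef \o place N) d (N + N)) => //= [j|j jN|].
- rewrite -normr_eq0 /place; case: ifP => jN.
    rewrite (_ : (N - j)%N = (N - j).-1.+1); last lia.
    by rewrite norm_rat_coef_neg invr_eq0 pnatr_eq0 -lt0n fact_gt0.
  by rewrite norm_rat_coef_pos pnatr_eq0 -lt0n fact_gt0.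
- have -> : `|d j|%:~R = `|d j|%N%:R :> rat by rewrite -abszE.
  apply: place_bound; rewrite /d; have := aP (place N j); have := bP (place N j); lia.
move/eqP: ab; rewrite -subr_eq0 -sumrB => /eqP ab; rewrite -[RHS]ab.
by apply: eq_bigr => j _; rewrite /d intrB mulrBl.
Qed.

Lemma fsbig_digits (f : nat -> rat) N : (forall s, (N < s)%N -> f s = 0) ->
  \sum_(s \in [set s : nat | (0 < s)%N]) f s = \sum_(0 <= i < N) f i.+1.
Proof.
move=> fN; rewrite (fsbigE (index_iota 1 N.+1)); first last.
- by move=> i /= i0; rewrite mem_index_iota => Hi; apply: fN; lia.
- by move=> i /=; rewrite mem_index_iota => /andP[].
- exact: iota_uniq.
by rewrite big_add1 /=; apply: eq_bigl => i; rewrite mem_set.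
Qed.

Lemma digit_sumE (a : int -> nat) N :
    (forall t, (a t <= `|t|)%N) -> (forall t, a t != 0%N -> (`|t| <= N)%N) ->
  is_digits (digit_sum a N) a.
Proof.
move=> aP aN.
have a0 t : (N < `|t|)%N -> a t = 0%N.
  by move=> Nt; apply/eqP; apply: contraTT Nt => /aN; rewrite -leqNgt.
split => //.
  apply: (@sub_finite_set _ _ [set` [seq place N i | i <- iota 0 (N + N)]]); last first.
    exact: finite_seq.
  move=> t /= at0; have t0 : t != 0.
    by apply: contraNneq at0 => ->; have := aP 0; rewrite leqn0.
  have [i iN <-] := place_surj t0 (aN _ at0).
  by apply/mapP; exists i; rewrite ?mem_iota.
rewrite !(@fsbig_digits _ N); first last.
- by move=> s sN; rewrite a0 ?mul0r//; lia.
- by move=> s sN; rewrite a0 ?mul0r//; lia.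
rewrite /digit_sum
  -(big_mkord xpredT (fun i => (a (place N i))%:R * rat_coef (place N i))).
rewrite (@big_cat_nat _ _ _ N)//= ?leq_addr//; congr (_ + _).
  rewrite big_nat_rev /= add0n big_nat [RHS]big_nat; apply: eq_bigr => i /= iN.
  rewrite /place ifT; last lia.
  rewrite (_ : (N - (N - i.+1))%N = i.+1); last lia.
  by rewrite /rat_coef oppr_lt0 (_ : `|- i.+1%:Z|%N = i.+1)// ltz_nat.
rewrite -{1}[N]add0n big_addn addnK; apply: eq_bigr => i _.
by rewrite /place ltnNge leq_addl /= addnK.
Qed.

Lemma is_digits_sum q a : is_digits q a ->
  exists N, forall M, (N <= M)%N ->
    (forall t, a t != 0%N -> (`|t| <= M)%N) /\ q = digit_sum a M.
Proof.
move=> [fa aP qE].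
have [N HN] : exists N, forall t, a t != 0%N -> (`|t| <= N)%N.
  exists (\max_(t <- fset_set [set t | a t != 0%N]) `|t|%N) => t at0.
  by apply: leq_bigmax_seq => //; rewrite in_fset_set// mem_set.
exists N => M NM.
have HM t : a t != 0%N -> (`|t| <= M)%N by move=> /HN /leq_trans; apply.
by split => //; have [_ _ ->] := digit_sumE aP HM.
Qed.

Lemma is_digits_inj q a b : is_digits q a -> is_digits q b -> a = b.
Proof.
move=> qa qb.
have [Na Ha] := is_digits_sum qa; have [Nb Hb] := is_digits_sum qb.
have [_ aP _] := qa; have [_ bP _] := qb.
apply/funext => t; have [->|t0] := eqVneq t 0.
  by have := aP 0; have := bP 0; rewrite !leqn0 => /eqP -> /eqP ->.
pose M := maxn `|t|%N (maxn Na Nb).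
have [|_ qaM] := Ha M; first by rewrite /M; lia.
have [|_ qbM] := Hb M; first by rewrite /M; lia.
apply: (@digit_sum_inj _ _ M) => //; last by rewrite /M; lia.
by rewrite -qaM -qbM.
Qed.

Lemma digitsE q a : is_digits q a -> digits q = a.
Proof.
move=> qa; apply: (@is_digits_inj q) => //.
by rewrite /digits; apply: xgetPex; exists a.
Qed.

Lemma digits0 : digits 0 = fun=> 0%N.
Proof.
apply: digitsE; rewrite (_ : 0 = digit_sum (fun=> 0%N) 0).
  exact: digit_sumE.
by rewrite /digit_sum big_ord0.
Qed.

Lemma dom_neq0 q x : dom q x -> q != 0.
Proof. by move=> [_]; apply: contraNneq => ->; rewrite digits0. Qed.

(** The coefficients [x j] are admissible digits at the places [t j], so by
uniqueness they are the digits of the sum. *)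
Lemma dom_sum n (t : 'I_n -> int) (x : 'I_n -> nat) :
    injective t -> (forall j, t j != 0) -> (forall j, (x j <= `|t j|)%N) ->
  dom (\sum_(j < n) (x j)%:R * rat_coef (t j)) =
  [set u | exists2 j, t j = u & x j != 0%N].
Proof.
move=> it t0 xt.
pose a (u : int) : nat := (\sum_(j < n | t j == u) x j)%N.
have aE j : a (t j) = x j.
  by rewrite /a (eq_bigl (pred1 j)) ?big_pred1_eq// => i; rewrite (inj_eq it).
have aN0 u : a u != 0%N -> exists j, t j = u.
  apply: contraNP => nj; rewrite /a big_pred0// => j.
  by apply/negP => /eqP tj; apply: nj; exists j.
pose N := (\max_j `|t j|)%N.
have aP u : (a u <= `|u|)%N.
  have [->//|/aN0[j <-]] := eqVneq (a u) 0%N; by rewrite aE.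
have aN u : a u != 0%N -> (`|u| <= N)%N.
  by move=> /aN0[j <-]; exact: leq_bigmax.
have sE : \sum_(j < n) (x j)%:R * rat_coef (t j) = digit_sum a N.
  rewrite /digit_sum.
  under [RHS]eq_bigr => i _ do rewrite /a natr_sum mulr_suml.
  rewrite (exchange_big_dep xpredT)//=; apply: eq_bigr => j _.
  have [i iN ij] := place_surj (t0 j) (leq_bigmax (F := fun j => `|t j|%N) j).
  rewrite (big_pred1 (Ordinal iN)) => [|i']; first by rewrite /= -/N ij.
  rewrite -/N -ij; apply/eqP/eqP => [/place_inj H|->//].
  exact/val_inj.
rewrite sE /dom (digitsE (digit_sumE aP aN)).
apply/seteqP; split => u /=.
  by move=> [_ au]; have [j tj] := aN0 u au; exists j => //; rewrite -aE tj.
by move=> [j <-]; rewrite aE.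
Qed.

(** * Combinatorial lines as arithmetic progressions *)

(** The letters are 0, ..., k - 1 and the digits 1, ..., k, hence the shift. *)
Definition word_value n k (t : n.-tuple int) (x : word 'I_n 'I_k) : rat :=
  \sum_(j < n) (x j).+1%:R * rat_coef (tnth t j).

Lemma card_rat_span_le n k (t : n.-tuple int) (A : set rat) :
  (#|` fset_set (A `&` rat_span t k.+1)| <=
   #|[pred x : word 'I_n 'I_k.+1 | `[< A (word_value t x) >]]|)%N.
Proof.
set P := [pred x | _].
have sub : A `&` rat_span t k.+1 `<=` [set` [seq word_value t x | x <- enum P]].
  move=> q [Aq [a [ak qE]]].
  pose x : word 'I_n 'I_k.+1 := [ffun j => inord (a j).-1].
  have qx : q = word_value t x.
    rewrite qE; apply: eq_bigr => j _; have /andP[a1 ak1] := ak j.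
    by rewrite ffunE inordK prednK.
  apply/mapP; exists x => //; rewrite mem_enum; apply/asboolP.
  by rewrite -qx.
rewrite cardE -(size_map (word_value t)).
apply: uniq_leq_size; first exact: fset_uniq.
have fin := sub_finite_set sub (finite_seq _).
by move=> q; rewrite in_fset_set// inE; exact: sub.
Qed.

Theorem theorem2p8 (R : realType) (k : nat) (k_gt0 : (0 < k)%N)
    (t : forall n : nat, n.-tuple int)
    (t_incr : forall (n : nat) (i j : 'I_n),
       (i < j)%N -> tnth (t n) i < tnth (t n) j)
    (t_ge : forall (n : nat) (j : 'I_n), (k <= `|tnth (t n) j|)%N)
    (A : set rat)
    (A_dense : (0 < limn_esup (fun n : nat =>
       ((#|` fset_set (A `&` rat_span (t n) k) |)%:R / (k ^ n)%:R : R)%:E))%E) :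
  exists p q : rat,
    [/\ A p, p != 0, q != 0,
        exists n : nat, [/\ (0 < n)%N,
          dom p `<=` [set x | x \in (t n : seq int)] &
          dom q `<=` [set x | x \in (t n : seq int)]]
      & forall i : nat, (i < k)%N -> A (p + i%:R * q)].
Proof.
case: k k_gt0 t_ge A_dense => // k _ t_ge /limn_esup_gt0[d d0 dA].
have [N HN] := DHJ_large (@DHJ_ord R k) d0.
(* [N.+1] instead of [N] makes the length of the words positive. *)
have [n Nn /ltW] := dA N.+1; rewrite lee_fin => dn.
have dn' : d <= density
    (fun x : word 'I_n 'I_k.+1 => `[< A (word_value (t n) x) >]) :> R.
  apply: (le_trans dn); rewrite /density /mean card_ffun !card_ord.
  apply: ler_wpM2r; first by rewrite invr_ge0 ler0n.
  rewrite -natr_sum ler_nat; apply: (leq_trans (card_rat_span_le _ _ _)).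
  rewrite -sum1_card big_mkcond; apply: leq_sum => x _ /=.
  by rewrite inE; case: asbool.
have [L /patternP[j Lj] LA] := HN n (ltnW Nn) _ dn'.
have tinj : injective (tnth (t n)).
  move=> i1 i2 e; apply/val_inj; case: (ltngtP i1 i2) => // /t_incr;
    by rewrite e ltxx.
have t0 i : tnth (t n) i != 0.
  by apply/eqP => ti; have := t_ge n i; rewrite ti.
have tk i (a : 'I_k.+1) : (a.+1 <= `|tnth (t n) i|)%N.
  exact: leq_trans (t_ge n i).
pose p := word_value (t n) (fill L ord0).
pose q := \sum_(i < n) (L i == None)%:R * rat_coef (tnth (t n) i).
have domp := dom_sum tinj t0 (fun i => tk i (fill L ord0 i)).
have domq := @dom_sum n _ (fun i => nat_of_bool (L i == None)) tinj t0
   (fun i => leq_trans (leq_b1 _) (tk i ord0)).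
exists p, q; split.
- exact/asboolP/LA.
- by apply: (@dom_neq0 _ (tnth (t n) j)); rewrite /p /word_value domp; exists j.
- by apply: (@dom_neq0 _ (tnth (t n) j)); rewrite /q domq; exists j; rewrite ?Lj.
- exists n; split; first exact: leq_trans Nn.
    by rewrite /p /word_value domp => _ [i <- _] /=; exact: mem_tnth.
  by rewrite /q domq => _ [i <- _] /=; exact: mem_tnth.
move=> i ik.
have /asboolP := LA (Ordinal ik); congr (A _).
rewrite /p /q /word_value mulr_sumr -big_split /=; apply: eq_bigr => l _.
rewrite mulrA -mulrDl; congr (_ * _).
rewrite !ffunE; case: (L l) => [b|] /=; first by rewrite mulr0 addr0.
by rewrite mulr1 addrC natr1.
Qed.
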